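(* Let $C=\{1,\ldots,\ell\}$, $A_k\in\mathbb{S}^\ell$ $(k=0,1,\ldots,m)$ and $D\subseteq\{(i,i):1\le i\le\ell\}$. For $\delta\in\mathbb{R}^m$ and $U\in\mathbb{S}^\ell(D)$ consider the SDP $$ \eta(\delta,U)=\inf\Big\{\langle A_0,Y\rangle:\ Y\in\mathbb{S}^\ell_+,\ \langle A_k,Y\rangle\le\delta_k\ (k=1,\ldots,m),\ [Y]_{ii}=U_{ii}\ ((i,i)\in D)\Big\}. $$ Suppose that one of the following conditions holds: (0) $D=\emptyset$ and $A_k$ $(k=0,\ldots,m)$ are positive semidefinite. (I) $D=\{(i,i)\}$ for some $i\in C$, and the principal submatrices $A_k^{C\setminus\{i\}}$ $(k=0,\ldots,m)$ are positive semidefinite. Then, for every $\delta\in\mathbb{R}^m$ and every $U\in\mathbb{S}^\ell(D)$, this SDP is exact, i.e., it has an optimal solution of rank at most one whenever it has an optimal solution.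
   Context: $\mathbb{S}^\ell$ is the space of real symmetric $\ell\times\ell$ matrices with inner product $\langle A,B\rangle=\sum_{i,j}[A]_{ij}[B]_{ij}$, and $\mathbb{S}^\ell_+$ is its cone of positive semidefinite matrices. For $A\in\mathbb{S}^\ell$ and $F\subseteq C$, $A^F$ denotes the principal submatrix of $A$ with rows and columns indexed by $F$. For a set $D$ of diagonal positions, $\mathbb{S}^\ell(D)$ is the set of partial matrices $U$ with real entries $U_{ii}$ specified for $(i,i)\in D$ (other entries unspecified). *)

(* Defs.v *)
From mathcomp Require Import all_boot all_order all_algebra.
From mathcomp Require Import classical_sets reals constructive_ereal ereal.

Set Implicit Arguments.
Unset Strict Implicit.
Unset Printing Implicit Defensive.

Import Order.TTheory GRing.Theory Num.Theory.

Local Open Scope ring_scope.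

Section MatrixNotions.
Variables (R : realType) (l : nat).

Definition mxinner (A B : 'M[R]_l) : R := \sum_i \sum_j A i j * B i j.

(* [A \is symmetricmx] unfolds to [A == (-1) ^+ false *: map_mx idfun A^T]. *)
Definition psdmx n (A : 'M[R]_n) : Prop :=
  A \is symmetricmx /\ forall x : 'cV[R]_n, 0 <= (x^T *m A *m x) 0 0.

(* Indexed by ['I_#|F|] through the increasing enumeration of [F]. *)
Definition principal_submx (A : 'M[R]_l) (F : {set 'I_l}) : 'M[R]_#|F| :=
  mxsub enum_val enum_val A.

Definition diag_positions : {set 'I_l * 'I_l} := [set (i, i) | i : 'I_l].

(* Only the entries at positions in [D] exist; the others are unspecified. *)
Definition partial_mx (D : {set 'I_l * 'I_l}) : Type := {p | p \in D} -> R.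

End MatrixNotions.

Section SDP.
Variables (R : realType) (l m : nat).
Variables (A : 'I_m.+1 -> 'M[R]_l) (D : {set 'I_l * 'I_l}).
Variables (delta : 'rV[R]_m) (U : partial_mx R D).

(* [A ord0] is the objective matrix; since ['I_m] starts at 0, the constraint
   matrix that goes with [delta 0 k] is [A (lift ord0 k)], of index [k.+1]. *)
Definition sdp_feasible (Y : 'M[R]_l) : Prop :=
  [/\ psdmx Y,
      forall k : 'I_m, mxinner (A (lift ord0 k)) Y <= delta 0 k
    & forall p : {p | p \in D}, Y (val p).1 (val p).2 = U p].

(* The value is [+oo] if the SDP is infeasible, [-oo] if it is unbounded. *)
Definition sdp_value : \bar R :=
  ereal_inf [set (mxinner (A ord0) Y)%:E | Y in sdp_feasible]%classic.

Definition sdp_optimal (Y : 'M[R]_l) : Prop :=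
  sdp_feasible Y /\ (mxinner (A ord0) Y)%:E = sdp_value.

Definition sdp_exact : Prop :=
  (exists Y, sdp_optimal Y) ->
  exists Y, sdp_optimal Y /\ (\rank Y <= 1)%N.

End SDP.

(* Main.v *)
Require Import Defs.
From mathcomp Require Import all_boot all_order all_algebra.
From mathcomp Require Import reals.
From mathcomp Require Import constructive_ereal ereal.
From mathcomp Require Import ring lra.

(** Any feasible [Y] can be replaced by a feasible matrix of rank at most one
    whose objective value is no larger; applied to an optimal [Y] this gives
    the theorem.

    When every [A k] is positive semidefinite and no entry is prescribed, the
    zero matrix will do, since the inner product of two positive semidefinite
    matrices is nonnegative. When the entry [(i, i)] is prescribed, let [c] be
    the [i]-th column of [Y] and split [Y] as [(Y i i)^-1 c c^T + Z]. The first
    term has rank at most one and agrees with [Y] at [(i, i)]. The Schur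
    complement [Z] is positive semidefinite and vanishes on row and column
    [i], so [mxinner (A k) Z] only sees the principal submatrix of [A k]
    off [i]; as this is positive semidefinite, [mxinner (A k) Z >= 0], and
    dropping [Z] increases neither the objective nor any constraint.

    The same splitting ([schur_complement_psd], [schur_complement_col0]),
    iterated over the indices, proves without any spectral theorem that the
    inner products above are nonnegative ([mxinner_ge0]). When [Y i i = 0] the
    convention [0^-1 = 0] makes the splitting trivial, with [Z = Y]; it remains
    valid because a positive semidefinite matrix with a zero diagonal entry
    vanishes on the whole column ([psd_diag0_col0]). *)

Set Implicit Arguments.
Unset Strict Implicit.
Unset Printing Implicit Defensive.

Import Order.TTheory GRing.Theory Num.Theory.

Local Open Scope ring_scope.

Section PositiveSemidefinite.
Variables (R : realType) (l : nat).
Implicit Types (A B Y Z : 'M[R]_l) (x : 'cV[R]_l) (S : {set 'I_l}).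

Definition qform n (A : 'M[R]_n) (x : 'cV[R]_n) : R := (x^T *m A *m x) 0 0.

Lemma qformE n (A : 'M[R]_n) (x : 'cV[R]_n) :
  qform A x = \sum_i \sum_j x i 0 * A i j * x j 0.
Proof.
rewrite /qform !mxE exchange_big; apply: eq_bigr => j _.
rewrite !mxE mulr_suml; apply: eq_bigr => i _.
by rewrite !mxE.
Qed.

Lemma symmetricmxE A : A \is symmetricmx -> forall i j, A i j = A j i.
Proof.
move=> /eqP eqA i j.
by rewrite {1}eqA expr0 scale1r !mxE.
Qed.

Lemma symmetricmxP A : (forall i j, A i j = A j i) -> A \is symmetricmx.
Proof.
move=> symA; apply/eqP/matrixP => i j.
by rewrite expr0 scale1r !mxE symA.
Qed.

Lemma mxinner_rank1 A x : mxinner A (x *m x^T) = qform A x.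
Proof.
rewrite qformE; apply: eq_bigr => i _; apply: eq_bigr => j _.
by rewrite !mxE big_ord1 !mxE; ring.
Qed.

Lemma mxinnerDr A B Z : mxinner A (B + Z) = mxinner A B + mxinner A Z.
Proof.
rewrite /mxinner -big_split; apply: eq_bigr => i _.
rewrite -big_split; apply: eq_bigr => j _.
by rewrite mxE mulrDr.
Qed.

Lemma mxinnerZr A a B : mxinner A (a *: B) = a * mxinner A B.
Proof.
rewrite /mxinner mulr_sumr; apply: eq_bigr => i _.
rewrite mulr_sumr; apply: eq_bigr => j _.
by rewrite mxE mulrCA.
Qed.

Lemma mxinner0r A : mxinner A 0 = 0.
Proof. by rewrite -(scale0r 0) mxinnerZr mul0r. Qed.

Lemma qform_shift Y x i t : Y \is symmetricmx ->
  qform Y (x + t *: delta_mx i 0) =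
  qform Y x + t * (Y *m x) i 0 *+ 2 + t ^+ 2 * Y i i.
Proof.
move=> symY.
have dY (u : 'cV[R]_l) : ((delta_mx i 0 : 'cV[R]_l)^T *m u) 0 0 = u i 0.
  by rewrite trmx_delta -rowE mxE.
have Yd : (x^T *m (Y *m (delta_mx i 0 : 'cV[R]_l))) 0 0 = (Y *m x) i 0.
  rewrite -colE !mxE; apply: eq_bigr => j _.
  by rewrite !mxE mulrC (symmetricmxE symY).
have dYd : (Y *m (delta_mx i 0 : 'cV[R]_l)) i 0 = Y i i by rewrite -colE mxE.
rewrite /qform -!mulmxA linearD linearZ /= mulmxDl !mulmxDr -!scalemxAr.
rewrite -!scalemxAl.
move: Yd (dY (Y *m x)) (dY (Y *m (delta_mx i 0 : 'cV[R]_l))); rewrite dYd.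
set xYd := x^T *m (Y *m delta_mx i 0); set dYx := _ *m (Y *m x).
set dYd' := _ *m (Y *m delta_mx i 0); set xYx := x^T *m _.
set s := (_ *m _) i 0.
move: xYd dYx dYd' xYx s => xYd dYx dYd' xYx s.
by rewrite !mxE => -> -> ->; ring.
Qed.

Lemma psd_diag_ge0 Y i : psdmx Y -> 0 <= Y i i.
Proof.
case=> symY /(_ (0 + 1 *: delta_mx i 0)).
rewrite -/(qform _ _) qform_shift // /qform !mulmx0 mxE.
by rewrite mxE; move=> h; lra.
Qed.

(** The form is affine along direction [i], and an affine function bounded below
    is constant. *)
Lemma psd_diag0_col0 Y i j : psdmx Y -> Y i i = 0 -> Y j i = 0.
Proof.
move=> [symY psdY] Yii0; apply/eqP/negPn/negP => Yji_neq0.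
(* The form at [delta_mx j 0 + t *: delta_mx i 0] is [Y j j + t * Y j i *+ 2];
   this [t] makes it equal to [-1]. *)
pose t := - (Y j j + 1) / (Y j i *+ 2).
have := psdY (delta_mx j 0 + t *: delta_mx i 0).
rewrite -/(qform _ _) qform_shift // Yii0 mulr0 addr0 -colE mxE.
rewrite /qform -mulmxA -colE trmx_delta -rowE !mxE (symmetricmxE symY i j).
rewrite (_ : _ + _ = -1); first by lra.
by rewrite /t; field.
Qed.

Definition schur_complement Y i : 'M[R]_l :=
  Y - (Y i i)^-1 *: (col i Y *m (col i Y)^T).

Lemma schur_complementE Y i j k :
  schur_complement Y i j k = Y j k - (Y i i)^-1 * (Y j i * Y k i).
Proof. by rewrite !mxE big_ord1 !mxE. Qed.

Lemma rank1_schur_decomposition Y i :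
  Y = (Y i i)^-1 *: (col i Y *m (col i Y)^T) + schur_complement Y i.
Proof. by rewrite /schur_complement addrC subrK. Qed.

(** The form of the Schur complement at [x] is the minimum of the form of [Y]
    over the line through [x] in direction [i], attained at the step
    [- (a^-1 * s)] below, so it inherits the nonnegativity of that form. *)
Lemma schur_complement_psd Y i : psdmx Y -> psdmx (schur_complement Y i).
Proof.
move=> [symY psdY]; split.
  apply: symmetricmxP => j k; rewrite !schur_complementE.
  by rewrite (symmetricmxE symY j k) (mulrC (Y j i)).
move=> x; rewrite -/(qform _ _).
set a := Y i i; set s := (Y *m x) i 0.
have -> : qform (schur_complement Y i) x = qform Y x - a^-1 * s ^+ 2.
  rewrite /schur_complement /qform mulmxBr mulmxBl.
  rewrite -scalemxAr -scalemxAl !mulmxA -(mulmxA _ _^T x).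
  have cx : ((col i Y)^T *m x) 0 0 = s.
    rewrite /s !mxE; apply: eq_bigr => j _.
    by rewrite !mxE (symmetricmxE symY).
  have xc : (x^T *m col i Y) 0 0 = s.
    by rewrite -cx -(trmxK (x^T *m _)) [LHS]mxE trmx_mul trmxK.
  move: (x^T *m Y *m x) (x^T *m col i Y) (_^T *m x) cx xc => b c d cx xc.
  by rewrite !mxE big_ord1 cx xc expr2.
have := psdY (x + (- (a^-1 * s)) *: delta_mx i 0).
rewrite -/(qform _ _) qform_shift // -/a -/s.
(* This form of cancellation also holds for [a = 0]. *)
have aVaa : a^-1 * a^-1 * a = a^-1.
  have [-> | a_neq0] := eqVneq a 0; first by rewrite invr0 !mul0r.
  by field.
congr (0 <= _); move: (a^-1) aVaa => b bba.
by ring: bba.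
Qed.

(** The diagonal entry is killed by construction, and the rest of the column
    follows by positive semidefiniteness. *)
Lemma schur_complement_col0 Y i j :
  psdmx Y -> schur_complement Y i j i = 0.
Proof.
move=> psdY; apply: psd_diag0_col0; first exact: schur_complement_psd.
rewrite schur_complementE.
have [-> | Yii_neq0] := eqVneq (Y i i) 0; first by rewrite !mulr0 subr0.
by field.
Qed.

(** Stating that a principal submatrix is positive semidefinite through vectors
    of full length avoids reindexing when [S] shrinks in an induction. *)
Definition supported_psd S A : Prop :=
  forall x, (forall i, i \notin S -> x i 0 = 0) -> 0 <= qform A x.

(** Splitting off one column at a time writes [Y] as a sum of matrices
    [a *: (c *m c^T)] with [0 <= a] and [c] supported on [S]; each contributes
    [a * qform A c]. Tracking the support lets [A] be positive on [S] only. *)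
Lemma mxinner_ge0 S A Y : supported_psd S A -> psdmx Y ->
  (forall i j, i \notin S -> Y j i = 0) -> 0 <= mxinner A Y.
Proof.
elim: {S}_.+1 {-2}S (ltnSn #|S|) Y => // n IHn S.
rewrite ltnS => leSn Y psdA psdY suppY.
have [S0 | [i iS]] := set_0Vmem S.
  have -> : Y = 0.
    by apply/matrixP => j k; rewrite suppY ?mxE // S0 inE.
  by rewrite mxinner0r.
have symY := symmetricmxE psdY.1.
rewrite (rank1_schur_decomposition Y i) mxinnerDr mxinnerZr mxinner_rank1.
apply: addr_ge0.
  apply: mulr_ge0; first by rewrite invr_ge0 psd_diag_ge0.
  by apply: psdA => j jS; rewrite mxE symY suppY.
apply: (IHn (S :\ i)).
- by apply: leq_trans leSn; rewrite (cardsD1 i S) iS.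
- move=> x suppx; apply: psdA => j jS; apply: suppx.
  by rewrite !inE negb_and jS orbT.
- exact: schur_complement_psd.
- move=> k j; rewrite !inE negb_and negbK => /orP[/eqP -> | kS].
    exact: schur_complement_col0.
  by rewrite schur_complementE !(symY k i) !(suppY k) // !mulr0 subr0.
Qed.

Lemma psd_supported S A : psdmx A -> supported_psd S A.
Proof. by move=> [_ psdA] x _; apply: psdA. Qed.

Lemma principal_submx_supported S A :
  psdmx (principal_submx A S) -> supported_psd S A.
Proof.
move=> [_ psdAS] x suppx.
have := psdAS (\col_k x (enum_val k) 0); rewrite -/(qform _ _).
congr (0 <= _); rewrite !qformE.
have sumS (F : 'I_l -> R) : (forall i, i \notin S -> F i = 0) ->
    \sum_i F i = \sum_(k < #|S|) F (enum_val k).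
  move=> F0; rewrite -big_enum_val [RHS]big_mkcond; apply: eq_bigr => i _.
  by case: ifPn => // /F0.
rewrite [RHS]sumS => [|i iS]; last first.
  by apply: big1 => j _; rewrite suppx // !mul0r.
apply: eq_bigr => k _; rewrite [RHS]sumS => [|j jS]; last first.
  by rewrite (suppx j) // mulr0.
by apply: eq_bigr => h _; rewrite !mxE.
Qed.

Lemma psd0 : psdmx (0 : 'M[R]_l).
Proof.
split=> [|x]; first by apply: symmetricmxP => i j; rewrite !mxE.
by rewrite mulmx0 mul0mx mxE.
Qed.

Lemma psd_rank1 a x : 0 <= a -> psdmx (a *: (x *m x^T)).
Proof.
move=> a_ge0; split=> [|y].
  by apply: symmetricmxP => i j; rewrite !mxE !big_ord1 !mxE (mulrC (x i 0)).
rewrite -scalemxAr -scalemxAl mulmxA -(mulmxA _ x^T y).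
have -> : x^T *m y = (y^T *m x)^T by rewrite trmx_mul trmxK.
move: (y^T *m x) => z; rewrite !mxE big_ord1 !mxE.
by rewrite mulr_ge0 // -expr2 sqr_ge0.
Qed.

End PositiveSemidefinite.

(** Each constraint and the objective are one of the functions
    [mxinner (A k)], so a matrix that decreases all of them and keeps the
    prescribed entries stays feasible, and is optimal if [Y] is. *)
Lemma sdp_exact_of_dominated (R : realType) (l m : nat)
    (A : 'I_m.+1 -> 'M[R]_l) (D : {set 'I_l * 'I_l})
    (delta : 'rV[R]_m) (U : partial_mx R D) :
  (forall Y, sdp_feasible A delta U Y -> exists Y',
     [/\ psdmx Y', (forall p, p \in D -> Y' p.1 p.2 = Y p.1 p.2),
         (forall k, mxinner (A k) Y' <= mxinner (A k) Y)
       & (\rank Y' <= 1)%N]) ->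
  sdp_exact A delta U.
Proof.
move=> dominated [Y [feasY optY]].
have [Y' [psdY' eqD leA rankY']] := dominated Y feasY.
have [psdY ineqY eqY] := feasY.
have feasY' : sdp_feasible A delta U Y'.
  split=> // [k | p]; first exact: le_trans (leA _) (ineqY k).
  by rewrite eqD ?eqY //; apply: valP.
exists Y'; split=> //; split=> //; apply/eqP; rewrite eq_le; apply/andP; split.
  by rewrite -optY lee_fin leA.
by apply: ereal_inf_lbound; exists Y'.
Qed.

Theorem theorem4p1 (R : realType) (l m : nat) (A : 'I_m.+1 -> 'M[R]_l)
    (D : {set 'I_l * 'I_l})
    (A_sym : forall k, A k \is symmetricmx)
    (D_diag : D \subset diag_positions l)
    (cond : (D = set0 /\ forall k, psdmx (A k)) \/
            (exists i : 'I_l, D = [set (i, i)] /\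
               forall k, psdmx (principal_submx (A k) [set~ i]))) :
  forall (delta : 'rV[R]_m) (U : partial_mx R D), sdp_exact A delta U.
Proof.
move=> delta U; apply: sdp_exact_of_dominated => Y [psdY _ _].
case: cond => [[D0 psdA] | [i [Di psdA]]].
  exists 0; split=> [|p|k|]; first exact: psd0.
  - by rewrite D0 inE.
  - rewrite mxinner0r.
    apply: (mxinner_ge0 (psd_supported (S := setT) (psdA k)) psdY).
    by move=> j h; rewrite inE.
  - by rewrite mxrank0.
exists ((Y i i)^-1 *: (col i Y *m (col i Y)^T)); split=> [|p|k|].
- by apply: psd_rank1; rewrite invr_ge0 psd_diag_ge0.
- rewrite Di inE => /eqP -> /=.
  rewrite [in RHS](rank1_schur_decomposition Y i) [RHS]mxE.
  by rewrite (schur_complement_col0 _ _ psdY) addr0.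
- rewrite [in leRHS](rank1_schur_decomposition Y i) mxinnerDr lerDl.
  apply: (mxinner_ge0 (principal_submx_supported (psdA k))).
    exact: schur_complement_psd.
  move=> h j; rewrite !inE negbK => /eqP ->; exact: schur_complement_col0.
- apply: leq_trans (mxrank_scale _ _) _.
  exact: leq_trans (mxrankM_maxl _ _) (rank_leq_col _).
Qed.
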